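(* Let $r \ge 3$ be an integer. For every integer $n \ge r$ and every noninteger real $t \in (0,r-2)$, there exists an $n \times n$ real totally positive Hankel matrix $A$ such that one of the leading principal minors of $A^{\circ t}$ of size $\le r$ is negative.
   Context: A square matrix $A=(a_{ij})_{1\le i,j\le n}$ is Hankel if $a_{ij}$ depends only on $i+j$. A real matrix is totally positive if every minor (determinant of a square submatrix, of any size) is positive. For a matrix $A=(a_{ij})$ with nonnegative real entries and real $t>0$, the Hadamard (entrywise) power is $A^{\circ t}=(a_{ij}^t)$. The leading principal minor of size $k$ is the determinant of the submatrix formed by the first $k$ rows and the first $k$ columns. *)

(* Defs.v *)
From mathcomp Require Import all_boot all_order all_algebra.
From mathcomp Require Import all_classical all_reals all_analysis.

Set Implicit Arguments.
Unset Strict Implicit.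
Unset Printing Implicit Defensive.

Import Order.TTheory GRing.Theory Num.Theory.
Local Open Scope ring_scope.

Definition hankel (R : realType) (n : nat) (A : 'M[R]_n) : Prop :=
  forall i j i' j' : 'I_n, (i + j = i' + j')%N -> A i j = A i' j'.

(* Row and column index sets of size k are given by their increasing
   enumerations f and g; the empty minor (k = 0) is 1. *)
Definition totally_positive (R : realType) (m n : nat) (A : 'M[R]_(m, n)) :
    Prop :=
  forall (k : nat) (f : 'I_k -> 'I_m) (g : 'I_k -> 'I_n),
    {homo f : i j / (i < j)%N} -> {homo g : i j / (i < j)%N} ->
    0 < \det (mxsub f g A).

(* Only meaningful for matrices with nonnegative entries. *)
Definition hadamard_pow (R : realType) (m n : nat) (A : 'M[R]_(m, n)) (t : R) :
    'M[R]_(m, n) :=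
  map_mx (fun x => x `^ t) A.

Definition leading_principal_minor (R : realType) (n k : nat)
    (le_kn : (k <= n)%N) (A : 'M[R]_n) : R :=
  \det (mxsub (widen_ord le_kn) (widen_ord le_kn) A).

(* Main.v *)
(** Let N = floor t. In the matrix ((1 + e x^(i+j))^t) of size N + 3, the
    binomial series gives V^T diag(binom(t,m) e^m) V up to negligible terms, V
    being a Vandermonde matrix, so for small e > 0 its determinant has the sign
    of the product of the binom(t,m), m <= N + 2, of which only the last one is
    negative. The Hankel matrix (1 + e x^(i+j)) has rank 2; it becomes totally
    positive after adding small masses at further nodes, since by Cauchy-Binet
    the moment matrix of a positive measure with at least n atoms in (0, oo) is
    totally positive. The generalized Vandermonde minors that occur there keep a
    common sign: eliminating one node expresses such a determinant through those
    of one size less whose exponents interlace the given ones. *)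

Require Import Defs.
From mathcomp Require Import all_boot all_order all_fingroup all_algebra.
From mathcomp Require Import all_classical all_reals all_analysis.
From mathcomp Require Import ring lra zify.

Set Implicit Arguments.
Unset Strict Implicit.
Unset Printing Implicit Defensive.

Import Order.TTheory GRing.Theory Num.Theory.
Local Open Scope ring_scope.

(** * Cauchy-Binet formula *)

(** Multilinearity in the rows: row [i] of [A *m B] combines the rows of [B], and [h i] records the
    one picked. *)
Lemma det_mulmx_rowsub (R : comPzRingType) (k N : nat)
    (A : 'M[R]_(k, N)) (B : 'M[R]_(N, k)) :
  \det (A *m B) =
    \sum_(h : {ffun 'I_k -> 'I_N}) (\prod_i A i (h i)) * \det (rowsub h B).
Proof.
pose AB (s : 'S_k) i j := A i j * B j (s i).
transitivity (\sum_(h : {ffun 'I_k -> 'I_N}) \sum_(s : 'S_k)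
    (-1) ^+ s * \prod_i AB s i (h i)).
  rewrite exchange_big; apply: eq_bigr => /= s _; rewrite -big_distrr /=.
  congr (_ * _); rewrite -(bigA_distr_bigA (AB s)) /=.
  by apply: eq_bigr => x _; rewrite mxE.
apply: eq_bigr => h _; rewrite big_distrr /=; apply: eq_bigr => s _.
rewrite [RHS]mulrCA big_split //=; congr (_ * (_ * _)).
by apply: eq_bigr => i _; rewrite mxE.
Qed.

(* The sum ranges over all maps h, not only the increasing ones, whence the
   factor k!: this avoids sorting, and non-injective h contribute 0. *)
Lemma cauchy_binet (R : comPzRingType) (k N : nat)
    (A : 'M[R]_(k, N)) (B : 'M[R]_(N, k)) :
  k`!%:R * \det (A *m B) =
    \sum_(h : {ffun 'I_k -> 'I_N}) \det (colsub h A) * \det (rowsub h B).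
Proof.
pose permh (s : 'S_k) (h : {ffun 'I_k -> 'I_N}) := [ffun i => h (s i)].
have permhK s : cancel (permh s) (permh s^-1%g).
  by move=> h; apply/ffunP => i; rewrite !ffunE permKV.
(* The copy of the expansion attached to [s] is reindexed by [h \o s]; the sign from permuting the
   rows of [B] makes the sum over [s] the Leibniz formula for [\det (colsub h A)]. *)
transitivity (\sum_(s : 'S_k) \sum_(h : {ffun 'I_k -> 'I_N})
    (\prod_i A i (h (s i))) * ((-1) ^+ s * \det (rowsub h B))).
  rewrite mulr_natl -card_Sn -sumr_const.
  apply: eq_big => [s|s _]; first by rewrite inE.
  rewrite det_mulmx_rowsub.
  rewrite (reindex_inj (can_inj (permhK s))) /=; apply: eq_bigr => h _.
  congr (_ * _); first by apply: eq_bigr => i _; rewrite ffunE.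
  rewrite -det_perm -det_mulmx -row_permE; congr (\det _).
  by apply/matrixP => i j; rewrite !mxE ffunE.
rewrite exchange_big; apply: eq_bigr => h _.
rewrite big_distrl /=; apply: eq_bigr => s _.
rewrite mulrCA mulrA; congr (_ * _ * _).
by apply: eq_bigr => i _; rewrite mxE.
Qed.

(** * Signs of generalized Vandermonde determinants *)

Lemma sumr_gt0 (R : numDomainType) (I : finType) (F : I -> R) (i0 : I) :
  (forall i, 0 <= F i) -> 0 < F i0 -> 0 < \sum_i F i.
Proof.
move=> F_ge0 F_gt0; rewrite (bigD1 i0) //= ltr_wpDr //.
by apply: sumr_ge0 => i _.
Qed.

Definition genvdm (R : pzSemiRingType) (k : nat) (f : 'I_k -> nat)
    (z : 'I_k -> R) : 'M[R]_k := \matrix_(i, j) z j ^+ f i.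

(* Subtracting w^(b-a) times the row of exponent a from the next row, of exponent
   b, kills the node w and leaves (z - w) times the sum of w^(b-1-m) z^m over
   a <= m < b: these are the coefficients of that sum. *)
Definition interlace_weight (R : pzSemiRingType) (k N : nat)
    (f : 'I_k.+1 -> nat) (w : R) : 'M[R]_(k, N) :=
  \matrix_(i, m) (if (f (widen_ord (leqnSn k) i) <= m < f (lift ord0 i))%N
                  then w ^+ (f (lift ord0 i) - m.+1) else 0).

(** The left side telescopes along [w ^+ (b - m) * z ^+ m]. Padding the sum with zeros up to [N]
    makes it an entry of a matrix product. *)
Lemma sub_expr_interlace (R : comPzRingType) (z w : R) (a b N : nat) :
  (a <= b <= N)%N ->
  z ^+ b - w ^+ (b - a) * z ^+ a =
    (\sum_(m < N) (if (a <= m < b)%N then w ^+ (b - m.+1) else 0) * z ^+ m)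
      * (z - w).
Proof.
move=> /andP[le_ab le_bN]; pose u m := w ^+ (b - m) * z ^+ m.
have -> : z ^+ b = u b by rewrite /u subnn mul1r.
rewrite -[w ^+ _ * _]/(u a) -telescope_sumr // big_distrl /=.
transitivity (\sum_(m < N | (a <= m < b)%N)
   w ^+ (b - m.+1) * z ^+ m * (z - w)); last first.
  by rewrite big_mkcond; apply: eq_bigr => m _; case: ifP; rewrite ?mul0r.
rewrite -(big_mkord (fun m => (a <= m < b)%N)
   (fun m => w ^+ (b - m.+1) * z ^+ m * (z - w))).
rewrite (big_nat_widen _ _ _ _ _ le_bN) (big_nat_widenl _ _ _ _ _ (leq0n a)) /=.
apply: eq_big => [m|m /andP[lt_mb _]]; first by rewrite andbC.
rewrite /u -(subnSK lt_mb) !exprS; ring.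
Qed.

(** The unitriangular [L] clears the first column below its top entry. The remaining block is
    weights times powers times a diagonal matrix, and [det_mulmx_rowsub] expands the first
    product. *)
Lemma det_genvdm_recl (R : comNzRingType) (k N : nat) (f : 'I_k.+1 -> nat)
    (z : 'I_k.+1 -> R) :
  {homo f : i j / (i < j)%N} -> (forall i, (f i <= N)%N) ->
  \det (genvdm f z) =
    z ord0 ^+ f ord0 * \prod_(j < k) (z (lift ord0 j) - z ord0) *
    \sum_(h : {ffun 'I_k -> 'I_N})
      (\prod_i interlace_weight N f (z ord0) i (h i)) *
      \det (genvdm (fun i => h i) (z \o lift ord0)).
Proof.
move=> f_homo le_fN; set w := z ord0.
pose L : 'M[R]_k.+1 := \matrix_(i, j)
  ((i == j)%:R - (i == j.+1 :> nat)%:R * w ^+ (f i - f j)).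
have detL : \det L = 1.
  rewrite det_trig; last first.
    apply/is_trig_mxP => i j lt_ij; rewrite mxE.
    have /negPf-> : i != j by rewrite neq_ltn lt_ij.
    by rewrite (ltn_eqF (leq_trans lt_ij (leqnSn j))) mul0r subr0.
  apply: big1 => i _.
  by rewrite mxE eqxx (ltn_eqF (ltnSn i)) mul0r subr0.
have LVE i j : (L *m genvdm f z) i j =
    z j ^+ f i - \sum_(i' < k.+1 | i == i'.+1 :> nat)
                    w ^+ (f i - f i') * z j ^+ f i'.
  rewrite mxE [in RHS]big_mkcond /=; under [LHS]eq_bigr do rewrite !mxE mulrBl.
  rewrite big_split /= sumrN; congr (_ - _).
    rewrite (bigD1 i) //= eqxx mul1r big1 ?addr0 // => i' ne_i'.
    by rewrite eq_sym (negPf ne_i') mul0r.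
  by apply: eq_bigr => i' _; case: eqP; rewrite ?mul0r ?mul1r.
have LV0 j : (L *m genvdm f z) ord0 j = z j ^+ f ord0.
  by rewrite LVE big_pred0 ?subr0.
have LVS i j : (L *m genvdm f z) (lift ord0 i) j =
  z j ^+ f (lift ord0 i) - w ^+ (f (lift ord0 i) - f (widen_ord (leqnSn k) i))
     * z j ^+ f (widen_ord (leqnSn k) i).
  rewrite LVE (big_pred1 (widen_ord (leqnSn k) i)) //.
have le_f (i : 'I_k) : (f (widen_ord (leqnSn k) i) <= f (lift ord0 i))%N.
  by apply/ltnW/f_homo; rewrite lift0.
rewrite -[LHS]mul1r -{1}detL -det_mulmx (expand_det_col _ ord0).
rewrite big_ord_recl big1 ?addr0 => [|i _]; last first.
  by rewrite LVS -/w -exprD subnK // subrr mul0r.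
rewrite LV0 -mulrA; congr (_ * _); rewrite /cofactor expr0 mul1r.
have -> : row' ord0 (col' ord0 (L *m genvdm f z)) =
  (interlace_weight N f w *m (\matrix_(m, j) z (lift ord0 j) ^+ (m : 'I_N)))
    *m diag_mx (\row_j (z (lift ord0 j) - w)).
  apply/matrixP => i j; rewrite mul_mx_diag 2![LHS]mxE LVS [RHS]mxE.
  rewrite (@sub_expr_interlace _ _ _ _ _ N) ?le_f ?le_fN // !mxE.
  by congr (_ * _); apply: eq_bigr => m _; rewrite !mxE.
rewrite det_mulmx det_diag mulrC det_mulmx_rowsub.
congr (_ * _); first by apply: eq_bigr => j _; rewrite mxE.
by apply: eq_bigr => h _; congr (_ * \det _); apply/matrixP => i j; rewrite !mxE.
Qed.

(** The nodes are unordered, so one determinant may have either sign; a product for two exponent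
    sequences expresses that this sign depends on the nodes alone. In the recursion the node
    differences then occur squared. *)
Lemma det_genvdm_mul_gt0 (R : realDomainType) (k : nat) (f g : 'I_k -> nat)
    (z : 'I_k -> R) :
  {homo f : i j / (i < j)%N} -> {homo g : i j / (i < j)%N} ->
  injective z -> (forall j, 0 < z j) ->
  0 < \det (genvdm f z) * \det (genvdm g z).
Proof.
elim: k => [|k IHk] in f g z *; first by rewrite !det_mx00 mulr1 ltr01.
move=> f_homo g_homo z_inj z_gt0.
pose N := \max_i maxn (f i) (g i).
have le_fN i : (f i <= N)%N by apply: leq_trans (leq_bigmax i); exact: leq_maxl.
have le_gN i : (g i <= N)%N by apply: leq_trans (leq_bigmax i); exact: leq_maxr.
rewrite (det_genvdm_recl z f_homo le_fN) (det_genvdm_recl z g_homo le_gN).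
set w := z ord0; set E := \prod_j _; set z' := z \o lift ord0.
have w_gt0 : 0 < w by exact: z_gt0.
have z'_inj : injective z' by apply: inj_comp z_inj (@lift_inj _ _).
have z'_gt0 j : 0 < z' j by exact: z_gt0.
have E_neq0 : E != 0.
  apply/prodf_neq0 => j _; rewrite subr_eq0; apply/eqP => /z_inj /eqP.
  by rewrite eq_sym (negPf (neq_lift _ _)).
pose P (e : 'I_k.+1 -> nat) (h : {ffun 'I_k -> 'I_N}) :=
  \prod_i interlace_weight N e w i (h i).
have P_ge0 e h : 0 <= P e h.
  by apply: prodr_ge0 => i _; rewrite mxE; case: ifP => // _; rewrite exprn_ge0 ?ltW.
(* A nonzero weight places each [h i] between consecutive exponents, in successive disjoint
   intervals. *)
have P_homo (e : 'I_k.+1 -> nat) (h : {ffun 'I_k -> 'I_N}) : {homo e : i j / (i < j)%N} ->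
    P e h != 0 -> {homo (fun i => h i : nat) : i j / (i < j)%N}.
  move=> e_homo /prodf_neq0 Ph i j lt_ij.
  have := Ph i isT; rewrite mxE; case: ifP => [/andP[_ ltf] _|_]; last by rewrite eqxx.
  have := Ph j isT; rewrite mxE; case: ifP => [/andP[gef _] _|_]; last by rewrite eqxx.
  apply: leq_trans ltf (leq_trans _ gef).
  have [->//|/eqP ne] := eqVneq (lift ord0 i) (widen_ord (leqnSn k) j).
  apply/ltnW/e_homo; rewrite ltn_neqAle lift0 lt_ij andbT /=.
  by apply/eqP => eq_ij; apply: ne; apply: ord_inj; rewrite lift0.
(* The witness takes the left endpoint of every interval. *)
have P_wit (e : 'I_k.+1 -> nat) : {homo e : i j / (i < j)%N} -> (forall i, (e i <= N)%N) ->
    exists2 h : {ffun 'I_k -> 'I_N}, 0 < P e h & P e h != 0.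
  move=> e_homo le_eN.
  have lt_e (i : 'I_k) : (e (widen_ord (leqnSn k) i) < e (lift ord0 i))%N.
    by apply/e_homo; rewrite lift0.
  have Ph : 0 < P e [ffun i => Ordinal (leq_trans (lt_e i) (le_eN _))].
    by apply: prodr_gt0 => i _; rewrite mxE ffunE /= leqnn lt_e exprn_gt0.
  by exists [ffun i => Ordinal (leq_trans (lt_e i) (le_eN _))]; rewrite // gt_eqF.
have -> (a b c d h : R) : a * b * c * (d * b * h) = (a * d) * b ^+ 2 * (c * h).
  by ring.
rewrite pmulr_rgt0; last first.
  by apply: mulr_gt0; [rewrite mulr_gt0 ?exprn_gt0|rewrite exprn_even_gt0].
rewrite big_distrl /=.
have term_ge0 h h' : 0 <= P f h * \det (genvdm (fun i => h i) z') *
    (P g h' * \det (genvdm (fun i => h' i) z')).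
  have [->|Ph] := eqVneq (P f h) 0; first by rewrite !mul0r.
  have [->|Ph'] := eqVneq (P g h') 0; first by rewrite mul0r mulr0.
  rewrite mulrACA mulr_ge0 ?(mulr_ge0 (P_ge0 _ _) (P_ge0 _ _)) //.
  by apply/ltW/IHk => //; [exact: P_homo _ _ f_homo Ph | exact: P_homo _ _ g_homo Ph'].
have [h Ph0 Ph] := P_wit f f_homo le_fN.
have [h' Ph'0 Ph'] := P_wit g g_homo le_gN.
apply: (@sumr_gt0 _ _ _ h) => [h1|]; rewrite big_distrr /=.
  by apply: sumr_ge0 => h2 _; exact: term_ge0.
apply: (@sumr_gt0 _ _ _ h') => [h2|]; first exact: term_ge0.
rewrite mulrACA mulr_gt0 ?(mulr_gt0 Ph0 Ph'0) //.
by apply: IHk => //; [exact: P_homo _ _ f_homo Ph | exact: P_homo _ _ g_homo Ph'].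
Qed.

(** * Total positivity of moment matrices *)

Lemma moment_hankel_totally_positive (R : realType) (n : nat) (c y : 'I_n -> R) :
  (forall l, 0 < c l) -> (forall l, 0 < y l) -> injective y ->
  totally_positive (\matrix_(i < n, j < n) \sum_l c l * y l ^+ (i + j)).
Proof.
move=> c_gt0 y_gt0 y_inj k f g f_homo g_homo.
pose A : 'M[R]_(k, n) := \matrix_(i, l) (y l ^+ f i * c l).
pose B : 'M[R]_(n, k) := \matrix_(l, j) y l ^+ g j.
have -> : mxsub f g (\matrix_(i, j) \sum_l c l * y l ^+ (i + j)) = A *m B.
  apply/matrixP => i j; rewrite !mxE; apply: eq_bigr => l _.
  by rewrite !mxE exprD; ring.
rewrite -(@pmulr_rgt0 _ k`!%:R) ?ltr0n ?fact_gt0 // cauchy_binet.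
have detE (h : {ffun 'I_k -> 'I_n}) :
    \det (colsub h A) * \det (rowsub h B) = \prod_i c (h i) *
    (\det (genvdm f (y \o h)) * \det (genvdm g (y \o h))).
  have -> : colsub h A = genvdm f (y \o h) *m diag_mx (\row_i c (h i)).
    by rewrite mul_mx_diag; apply/matrixP => i j; rewrite !mxE.
  have -> : rowsub h B = (genvdm g (y \o h))^T.
    by apply/matrixP => i j; rewrite !mxE.
  rewrite det_mulmx det_diag det_tr.
  by under eq_bigr do rewrite mxE; ring.
have C_gt0 (h : 'I_k -> 'I_n) : 0 < \prod_i c (h i) by apply: prodr_gt0.
have inj_gt0 (h : {ffun 'I_k -> 'I_n}) : injective h ->
    0 < \det (colsub h A) * \det (rowsub h B).
  move=> h_inj; rewrite detE mulr_gt0 //.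
  apply: det_genvdm_mul_gt0 => // [|j]; last exact: y_gt0.
  exact: inj_comp.
(* Any injective map would do as the positive term; [f] is one at hand. *)
apply: (@sumr_gt0 _ _ _ [ffun i => f i]) => [h|].
  have [/injectiveP h_inj|/injectivePn[i [j ne_ij eq_h]]] := boolP (injectiveb h).
    exact/ltW/inj_gt0.
  rewrite [X in _ * X](determinant_alternate ne_ij) ?mulr0 // => l.
  by rewrite !mxE eq_h.
apply: inj_gt0 => i j; rewrite !ffunE => eq_f.
have [/f_homo|/f_homo|/val_inj//] := ltngtP i j; by rewrite eq_f ltnn.
Qed.

(** * Binomial expansion of real powers *)

Import numFieldNormedType.Exports.
Local Open Scope classical_set_scope.

Definition gbin (R : fieldType) (t : R) (m : nat) : R :=
  (\prod_(i < m) (t - i%:R)) / m`!%:R.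

Definition binom_poly (R : fieldType) (t : R) (k : nat) : {poly R} :=
  \poly_(m < k) gbin t m.

Lemma gbinS (R : numFieldType) (t : R) (m : nat) :
  gbin t m.+1 *+ m.+1 = t * gbin (t - 1) m.
Proof.
rewrite /gbin big_ord_recl subr0 factS natrM -[_ *+ _]mulr_natr.
have -> : \prod_(i < m) (t - (lift ord0 i)%:R) = \prod_(i < m) (t - 1 - i%:R).
  by apply: eq_bigr => i _; rewrite lift0 -natr1; ring.
by rewrite mulrAC invfM mulrA mulfK ?pnatr_eq0 // mulrA.
Qed.

Lemma deriv_binom_poly (R : numFieldType) (t : R) (k : nat) :
  deriv (binom_poly t k.+1) = t *: binom_poly (t - 1) k.
Proof.
apply/polyP => m; rewrite coef_deriv coefZ !coef_poly ltnS.
by case: ifP => _; rewrite ?gbinS // mul0rn mulr0.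
Qed.

(** Induction on [k] for all [t]: the derivative of the remainder is [t] times the previous
    remainder for [t - 1], and the mean value theorem gains one factor [u]. *)
Lemma powR_binom_remainder (R : realType) (k : nat) (t : R) :
  exists2 C : R, 0 <= C & forall u : R, 0 <= u <= 1 ->
    `|(1 + u) `^ t - (binom_poly t k).[u]| <= C * u ^+ k.
Proof.
elim: k => [|k IHk] in t *.
  (* The exponent may be negative, as the induction lowers it; hence the absolute value. *)
  exists (2 `^ `|t|) => [|u /andP[u0 u1]]; first exact: powR_ge0.
  have -> : binom_poly t 0 = 0 by apply/polyP => m; rewrite coef_poly coef0.
  rewrite horner0 subr0 expr0 mulr1 ger0_norm ?powR_ge0 //.
  apply: (@le_trans _ _ ((1 + u) `^ `|t|)).
    by apply: ler_powR; [lra|exact: ler_norm].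
  by apply: ge0_ler_powR; rewrite ?nnegrE //; lra.
have [C C0 boundC] := IHk (t - 1).
exists (`|t| * C) => [|u /andP[u0 u1]]; first exact: mulr_ge0.
pose f (v : R) := (1 + v) `^ t - (binom_poly t k.+1).[v].
pose df (v : R) := t * ((1 + v) `^ (t - 1) - (binom_poly (t - 1) k).[v]).
have f_drv (v : R) : 0 <= v -> is_derive v 1 f (df v).
  move=> v0; have v1 : 0 < 1 + v by lra.
  have drv1 : is_derive v 1 (fun v : R => (1 + v) `^ t) (t * (1 + v) `^ (t - 1)).
    have h1 : is_derive v (1 : R) (fun v : R => 1 + v) 1.
      have := is_deriveD (is_derive_cst (1 : R) v (1 : R)) (is_derive_id v (1 : R)).
      by rewrite add0r.
    have h2 := is_derive1_powR t v1.
    have h3 := @is_derive1_comp R (@powR R ^~ t) (+%R 1) v _ _ h2 h1.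
    by rewrite mulr1 in h3; exact: h3.
  have drv2 := is_derive_poly (binom_poly t k.+1) v.
  have := is_deriveB drv1 drv2.
  by rewrite deriv_binom_poly hornerZ -mulrBr.
have [||c /andP[c0 cu]] := @MVT_segment R f df 0 u u0.
- by move=> v /andP[v0 _]; apply: f_drv; exact: ltW.
- apply: derivable_within_continuous => v /andP[v0 _].
  by have [] := f_drv v v0.
rewrite !bnd_simp in c0 cu.
have -> : f 0 = 0.
  rewrite /f addr0 powR1 horner_coef0 coef_poly /= /gbin big_ord0 fact0.
  by rewrite mul1r invr1 subrr.
rewrite !subr0 /f => ->; rewrite !normrM (ger0_norm u0) exprSr mulrA.
apply: ler_wpM2r => //; rewrite -mulrA; apply: ler_wpM2l => //.
apply: (le_trans (boundC c _)); first by rewrite c0 (le_trans cu).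
by apply: ler_wpM2l => //; apply: lerXn2r; rewrite ?nnegrE.
Qed.

(** * Negative determinant for the rank-two matrix *)

Lemma cvg_det (R : realType) (T : Type) (F : set_system T) {FF : Filter F}
    (k : nat) (M : T -> 'M[R]_k) (L : 'M[R]_k) :
  (forall i j, M x i j @[x --> F] --> L i j) ->
  \det (M x) @[x --> F] --> \det L.
Proof.
move=> cvgM_; apply: cvg_big => [|s _]; first exact: add_continuous.
apply: cvgM; first exact: cvg_cst.
by apply: cvg_big => [|i _]; [exact: mul_continuous|exact: cvgM_].
Qed.

Lemma Vandermonde_expr_unitmx (R : realFieldType) (k : nat) (x : R) : 1 < x ->
  Vandermonde k (\row_(j < k) x ^+ j) \in unitmx.
Proof.
move=> x1; rewrite unitmxE det_Vandermonde unitfE.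
apply/prodf_neq0 => i _; apply/prodf_neq0 => j lt_ij; rewrite !mxE.
by rewrite subr_eq0 gt_eqF // ltr_eXn2l.
Qed.

(* Writing the power matrix as V^T D V + R with D = diag (gbin t m * e^m) and
   V the Vandermonde matrix of the x^j, the remainder R is O(e^k) whereas every
   diagonal entry of D is at least of order e^(k-1); hence the determinant is
   equivalent to det V ^ 2 * det D. *)
Lemma det_powR_rank2_lt0 (R : realType) (k : nat) (t x : R) :
  1 < x -> \prod_(m < k) gbin t m < 0 ->
  \forall e \near 0^'+,
    \det (\matrix_(i < k, j < k) (1 + e * x ^+ (i + j)) `^ t) < 0.
Proof.
move=> x1 prod_lt0; have x0 : 0 < x by lra.
have c_neq0 (m : 'I_k) : gbin t m != 0.
  have /prodf_neq0 /(_ m isT) // : \prod_(m < k) gbin t m != 0 by rewrite lt_eqF.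
pose V := Vandermonde k (\row_(j < k) x ^+ j).
have Vu : V \in unitmx by exact: Vandermonde_expr_unitmx.
pose M e : 'M[R]_k := \matrix_(i, j) (1 + e * x ^+ (i + j)) `^ t.
pose P e : 'M[R]_k := \matrix_(i, j) (binom_poly t k).[e * x ^+ (i + j)].
pose D e : 'M[R]_k := diag_mx (\row_m (gbin t m * e ^+ m)).
have PE e : P e = V^T *m D e *m V.
  apply/matrixP => i j; rewrite mul_mx_diag !mxE horner_poly.
  by apply: eq_bigr => m _; rewrite !mxE exprMn exprD -!exprM exprMn -!exprM; ring.
(* [E e] is the remainder moved inside the factorization, so that
   [M e = V^T *m D e *m (1 + E e) *m V]. *)
pose E e := diag_mx (\row_m (gbin t m * e ^+ m)^-1) *m
  (invmx V^T *m (M e - P e) *m invmx V).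
have VTu : V^T \in unitmx by rewrite unitmx_tr.
have ME e : 0 < e -> M e = V^T *m D e *m (1%:M + E e) *m V.
  move=> e0; rewrite mulmxDr mulmxDl mulmx1 -PE /E.
  have -> : V^T *m D e *m (diag_mx (\row_m (gbin t m * e ^+ m)^-1) *m
     (invmx V^T *m (M e - P e) *m invmx V)) *m V = M e - P e.
    rewrite -!mulmxA mulVmx // mulmx1 [D e *m _]mulmxA.
    have -> : D e *m diag_mx (\row_m (gbin t m * e ^+ m)^-1) = 1%:M.
      apply/matrixP => i j; rewrite mul_mx_diag !mxE.
      case: eqP => [->|_]; last by rewrite mulr0n mul0r.
      by rewrite !mulr1n divff // mulf_neq0 // expf_neq0 // gt_eqF.
    by rewrite mul1mx mulmxA mulmxV // mul1mx.
  by rewrite addrC subrK.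
have [C C0 boundC] := powR_binom_remainder k t.
(* Remainder entries are at most [K * e ^+ k]; since [m < k], division by [e ^+ m] leaves at least
   one factor [e]. *)
have R_cvg (m i j : 'I_k) :
    (M e - P e) i j / e ^+ m @[e --> 0^'+] --> (0 : R).
  pose K := C * (x ^+ (i + j)) ^+ k.
  have K0 : 0 <= K by rewrite mulr_ge0 // !exprn_ge0 // ltW.
  have K_cvg : K * e @[e --> 0^'+] --> (0 : R).
    rewrite -[X in _ --> X](mulr0 K); apply: cvgM; first exact: cvg_cst.
    by apply: cvg_at_right_filter; exact: cvg_id.
  apply/cvgr0Pnorm_le => d d0.
  near=> e.
  have e0 : 0 < e by near: e; exact: nbhs_right_gt.
  have e1 : e <= 1 by near: e; apply: nbhs_right_le.
  have ex1 : e <= (x ^+ (i + j))^-1.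
    by near: e; apply: nbhs_right_le; rewrite invr_gt0 exprn_gt0.
  have Ked : K * e <= d by near: e; exact: (cvgr_le 0).
  apply: le_trans Ked; rewrite !mxE normrM normfV (gtr0_norm (exprn_gt0 _ e0)).
  rewrite ler_pdivrMr ?exprn_gt0 //.
  apply: (le_trans (boundC _ _)).
    apply/andP; split; first by rewrite mulr_ge0 ?exprn_ge0 // ltW.
    by rewrite -ler_pdivlMr ?exprn_gt0 // div1r.
  rewrite exprMn (_ : C * _ = K * e ^+ k); last by rewrite /K; ring.
  rewrite -[leRHS]mulrA; apply: ler_wpM2l => //; rewrite -exprS.
  by apply: ler_wiXn2l; rewrite ?ltW.
have E_cvg (m l : 'I_k) : E e m l @[e --> 0^'+] --> (0 : R).
  have -> : (fun e => E e m l) = (fun e => \sum_j \sum_i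
      ((gbin t m)^-1 * invmx V^T m i * invmx V j l) *
      ((M e - P e) i j / e ^+ m)).
    apply/funext => e; rewrite /E mul_diag_mx !mxE big_distrr.
    apply: eq_bigr => j _; rewrite [in LHS]mxE big_distrl big_distrr.
    by apply: eq_bigr => i _; rewrite /= invfM; ring.
  rewrite [X in _ --> X](_ : 0 = \sum_(j < k) \sum_(i < k)
      ((gbin t m)^-1 * invmx V^T m i * invmx V j l) * 0); last first.
    by rewrite big1 // => j _; rewrite big1 // => i _; rewrite mulr0.
  apply: cvg_big => [|j _]; first exact: add_continuous.
  apply: cvg_big => [|i _]; first exact: add_continuous.
  by apply: cvgM; [exact: cvg_cst|exact: R_cvg].
have det_cvg : \det (1%:M + E e) @[e --> 0^'+] --> (1 : R).
  rewrite -[X in _ --> X](det1 R k) -[X in \det X]addr0.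
  apply: cvg_det => i j.
  rewrite [X in _ --> X]mxE [X in _ --> _ + X]mxE.
  under eq_fun do rewrite mxE.
  by apply: cvgD; [exact: cvg_cst|exact: E_cvg].
near=> e.
have e0 : 0 < e by near: e; exact: nbhs_right_gt.
have det_gt0 : 0 < \det (1%:M + E e) by near: e; exact: (cvgr_gt 1).
rewrite -/(M e) ME // !det_mulmx det_tr det_diag.
under eq_bigr do rewrite mxE.
rewrite big_split /= (_ : _ * _ * _ * _ = (\prod_(m < k) gbin t m) *
  (\det V ^+ 2 * \prod_(m < k) e ^+ m * \det (1%:M + E e))); last by ring.
rewrite pmulr_llt0 //; apply: mulr_gt0 => //; apply: mulr_gt0.
  by rewrite exprn_even_gt0 //= -unitfE -unitmxE.
by apply: prodr_gt0 => m _; exact: exprn_gt0.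
Unshelve. all: by end_near. Qed.

(** The factors [t - i] are positive for [i <= N]; [t - N.+1] is negative and enters only the last
    coefficient. *)
Lemma prod_gbin_lt0 (R : numFieldType) (t : R) (N : nat) :
  N%:R < t < N.+1%:R -> \prod_(m < N.+3) gbin t m < 0.
Proof.
move=> /andP[ltNt lttN].
have prod_gt0 m : (m <= N.+1)%N -> 0 < \prod_(i < m) (t - i%:R).
  move=> le_m; apply: prodr_gt0 => i _; rewrite subr_gt0.
  by apply: le_lt_trans ltNt; rewrite ler_nat -ltnS (leq_trans (ltn_ord i)).
rewrite big_ord_recr /= pmulr_rlt0; last first.
  by apply: prodr_gt0 => m _; rewrite divr_gt0 ?prod_gt0 // ?ltr0n ?fact_gt0 // -ltnS.
rewrite /gbin pmulr_llt0 ?invr_gt0 ?ltr0n ?fact_gt0 // big_ord_recr /=.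
by rewrite pmulr_rlt0 ?prod_gt0 // subr_lt0.
Qed.

(** * Perturbation to a totally positive matrix *)

Lemma cvg_powR (R : realType) (T : Type) (F : set_system T) {FF : Filter F}
    (f : T -> R) (a t : R) :
  0 < a -> f x @[x --> F] --> a -> f x `^ t @[x --> F] --> a `^ t.
Proof.
move=> a0 fa; apply: (@continuous_cvg _ _ _ F FF f (@powR R ^~ t)) fa.
apply/differentiable_continuous/derivable1_diffP.
by have [] := is_derive1_powR t a0.
Qed.

Theorem mainTheorem5 (R : realType) (r : nat) (hr : (3 <= r)%N)
    (n : nat) (hn : (r <= n)%N) (t : R) (ht0 : 0 < t) (htr : t < r%:R - 2)
    (htZ : t \isn't a Num.int) :
  exists A : 'M[R]_n,
    [/\ hankel A, totally_positive A &
      exists (k : nat) (le_kn : (k <= n)%N),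
        (k <= r)%N /\ leading_principal_minor le_kn (hadamard_pow A t) < 0].
Proof.
pose N := Num.truncn t.
have /andP[leNt lttN] := truncn_itv (ltW ht0).
have ltNt : N%:R < t.
  rewrite lt_neqAle leNt andbT; apply/eqP => tE.
  by move: htZ; rewrite -tE natr_int.
(* From [N < t < r - 2], integrality gives [N + 3 <= r]. *)
have le_kr : (N.+3 <= r)%N.
  have : (N%:R : R) + 2 < r%:R by lra.
  by rewrite -natrD ltr_nat; lia.
have le_kn := leq_trans le_kr hn.
pose s (i j : nat) : R := \sum_(l < n) l.+1%:R ^+ (i + j).
have near_e : \forall e \near (0 : R)^'+, 0 < e /\
    \det (\matrix_(i < N.+3, j < N.+3) (1 + e * 2 ^+ (i + j)) `^ t) < 0.
  apply: filterI; first exact: nbhs_right_gt.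
  by apply: det_powR_rank2_lt0; [lra|apply: prod_gbin_lt0; rewrite ltNt].
have [e [e0 det_e]] := filter_ex near_e.
have det_cvg : \det (\matrix_(i < N.+3, j < N.+3)
      (1 + e * 2 ^+ (i + j) + d * s i j) `^ t) @[d --> (0 : R)^'+] -->
    \det (\matrix_(i < N.+3, j < N.+3) (1 + e * 2 ^+ (i + j)) `^ t).
  apply: cvg_det => i j; rewrite [X in _ --> X]mxE.
  under eq_fun do rewrite mxE.
  apply: cvg_powR; first by rewrite addr_gt0 // mulr_gt0 // exprn_gt0.
  rewrite -[X in _ --> X]addr0 -[X in _ --> _ + X](mul0r (s i j)).
  apply: cvgD; first exact: cvg_cst.
  apply: cvgM; last exact: cvg_cst.
  by apply: cvg_at_right_filter; exact: cvg_id.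
(* With [e] fixed, continuity in [d] preserves the negative sign. *)
have near_d : \forall d \near (0 : R)^'+, 0 < d /\
    \det (\matrix_(i < N.+3, j < N.+3)
      (1 + e * 2 ^+ (i + j) + d * s i j) `^ t) < 0.
  by apply: filterI; [exact: nbhs_right_gt|exact: (cvgr_lt _ det_cvg)].
have [d [d0 det_d]] := filter_ex near_d.
(* Index [l] carries the node [l + 1]: masses 1 and [e] at the nodes 1 and 2 give the rank-two part,
   and [d] is added at every node. *)
pose c (l : 'I_n) : R := (l == 0%N :> nat)%:R + e * (l == 1%N :> nat)%:R + d.
have lt1n : (1 < n)%N by lia.
have momentE (p : nat) : \sum_l c l * l.+1%:R ^+ p =
    1 + e * 2 ^+ p + d * \sum_(l < n) l.+1%:R ^+ p.
  have pick (a : nat) (lt_an : (a < n)%N) :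
      \sum_(l < n) (l == a :> nat)%:R * l.+1%:R ^+ p = (a.+1%:R : R) ^+ p.
    rewrite (bigD1 (Ordinal lt_an)) //= eqxx mul1r big1 ?addr0 // => l ne_l.
    by rewrite -[_ == a]/(l == Ordinal lt_an) (negPf ne_l) mul0r.
  under eq_bigr do rewrite !mulrDl -mulrA.
  by rewrite !big_split -!big_distrr /= !pick ?expr1n // ltnW.
exists (\matrix_(i < n, j < n) \sum_l c l * l.+1%:R ^+ (i + j)); split.
- by move=> i j i' j' eq_ij; rewrite !mxE eq_ij.
- apply: moment_hankel_totally_positive => [l|l|l l' /eqP].
  + by rewrite ltr_wpDl // addr_ge0 // mulr_ge0 // ltW.
  + by rewrite ltr0n.
  + by rewrite eqr_nat eqSS => /eqP/val_inj.
exists N.+3, le_kn; split => //; rewrite /leading_principal_minor.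
rewrite (_ : mxsub _ _ _ = \matrix_(i < N.+3, j < N.+3)
      (1 + e * 2 ^+ (i + j) + d * s i j) `^ t) //.
by apply/matrixP => i j; rewrite !mxE momentE.
Qed.
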